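(* Let $f$ be a block function on $(\omega,<)$ which is not intrinsically computable on a cone. Then $f$ is intrinsically of c.e. degree on a cone if and only if there are infinitely many $f$-blocks that do not embed into a later $f$-block.
   Context: Let $(\omega,<)$ be the standard order on $\omega$. A copy of $(\omega,<)$ is a linear order $\mathcal{L}=(L,\prec)$ with $L\subseteq\omega$ isomorphic to $(\omega,<)$; it is $X$-computable if $L,\prec$ are $X$-computable. With $\pi_{\mathcal{L}}:\mathcal{L}\to(\omega,<)$ the unique isomorphism, set $f^{\mathcal{L}}=\pi_{\mathcal{L}}^{-1}\circ f\circ\pi_{\mathcal{L}}$. The degree spectrum relative to $X$ is $\mathrm{DgSp}^X(f)=\{\deg_T(f^{\mathcal{L}}\oplus X):\mathcal{L}\text{ an }X\text{-computable copy of }(\omega,<)\}$. $f$ is intrinsically computable on a cone if there is $X$ with $\mathrm{DgSp}^Y(f)=\{\deg_T(Y)\}$ for all $Y\ge_T X$; $f$ is intrinsically of c.e. degree on a cone if there is $X$ such that for all $Y\ge_T X$ every element of $\mathrm{DgSp}^Y(f)$ is of the form $\deg_T(A\oplus Y)$ with $A$ c.e. in $Y$. A function $f:\omega\to\omega$ is a block function if every $n$ lies in a finite interval $[a,b]$ with $f([a,b])\subseteq[a,b]$ and $f^{-1}([a,b])\subseteq[a,b]$; the minimal such interval is the $f$-block of $n$ (the $f$-blocks partition $\omega$). An $f$-block $B$ embeds into an $f$-block $C$ if there is an order-preserving injection $h:B\to C$ with $h(f(x))=f(h(x))$ for all $x\in B$; $C$ is later than $B$ if all elements of $C$ exceed all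 elements of $B$. *)

(* Defs.v *)
From mathcomp Require Import all_boot classical_sets functions cardinality.
From Stdlib Require Cantor.

Set Implicit Arguments.
Unset Strict Implicit.
Unset Printing Implicit Defensive.

Local Open Scope classical_set_scope.

(** * Computability relative to an oracle *)

Definition npair (a b : nat) : nat := Cantor.to_nat (a, b).
Definition nfst (n : nat) : nat := (Cantor.of_nat n).1.
Definition nsnd (n : nat) : nat := (Cantor.of_nat n).2.

(** Programs for the unary partial recursive functions relative to an oracle;
    functions of several arguments are coded with the pairing [npair]. *)
Inductive prog : Type :=
| PZero | PSucc | PFst | PSnd | POracle
| PPair of prog & prog
| PComp of prog & prog
| PRec of prog & prog
| PMu of prog.

(** [computes X p n v]: with oracle [X], program [p] halts on input [n] with
    output [v].  [PRec p q] maps [npair a 0] to [p a] and [npair a k.+1] to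
    [q (npair a (npair k u))], where [u] is its value at [npair a k].
    [PMu p] maps [n] to the least [v] with [p (npair n v) = 0], and requires
    [p] to be defined at [npair n m] for all [m < v]. *)
Fixpoint computes (X : set nat) (p : prog) (n v : nat) {struct p} : Prop :=
  match p with
  | PZero => v = 0
  | PSucc => v = n.+1
  | PFst => v = nfst n
  | PSnd => v = nsnd n
  | POracle => (X n /\ v = 1) \/ (~ X n /\ v = 0)
  | PPair p q =>
      exists a b, [/\ computes X p n a, computes X q n b & v = npair a b]
  | PComp p q => exists2 m, computes X q n m & computes X p m v
  | PRec p q =>
      nat_rect (fun _ => nat -> Prop)
        (computes X p (nfst n))
        (fun k R w =>
           exists2 u, R u & computes X q (npair (nfst n) (npair k u)) w)
        (nsnd n) v
  | PMu p =>
      computes X p (npair n v) 0 /\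
      (forall m, m < v -> exists u, computes X p (npair n m) u.+1)
  end.

Definition turing_le (A X : set nat) : Prop :=
  exists p, forall n,
    (A n -> computes X p n 1) /\ (~ A n -> computes X p n 0).

Definition turing_equiv (A B : set nat) : Prop :=
  turing_le A B /\ turing_le B A.

Definition ce_in (A X : set nat) : Prop :=
  exists p, forall n, A n <-> exists v, computes X p n v.

Definition degree (A : set nat) : set (set nat) :=
  [set B | turing_equiv A B].

Definition join (A B : set nat) : set nat :=
  [set n | if odd n then B n./2 else A n./2].

Definition code_rel (R : nat -> nat -> Prop) : set nat :=
  [set n | R (nfst n) (nsnd n)].

(** * Copies of the standard order and degree spectra *)

(** [prec] is a relation on [L], and [pi] restricted to [L] is an isomorphism
    from [(L, prec)] onto the natural numbers with their strict order (so
    [(L, prec)] is a linear order, and [pi] is unique on [L]). *)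
Definition copy_of_omega
    (L : set nat) (prec : nat -> nat -> Prop) (pi : nat -> nat) : Prop :=
  [/\ forall x y, prec x y -> L x /\ L y,
      set_bij L setT pi
    & forall x y, L x -> L y -> (prec x y <-> pi x < pi y)].

Definition computable_order
    (X L : set nat) (prec : nat -> nat -> Prop) : Prop :=
  turing_le L X /\ turing_le (code_rel prec) X.

(** The graph of [f] transported along [pi] to a partial function with domain
    [L].  When [L] is [X]-computable, the join of this graph with [X] has the
    same degree as the join of the function itself with [X]. *)
Definition transport_graph
    (f : nat -> nat) (L : set nat) (pi : nat -> nat) : nat -> nat -> Prop :=
  fun x y => [/\ L x, L y & pi y = f (pi x)].

Definition DgSp (X : set nat) (f : nat -> nat) : set (set (set nat)) :=
  [set d | exists (L : set nat) (prec : nat -> nat -> Prop) (pi : nat -> nat),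
     [/\ copy_of_omega L prec pi,
         computable_order X L prec
       & d = degree (join (code_rel (transport_graph f L pi)) X)]].

Definition intrinsically_computable_on_cone (f : nat -> nat) : Prop :=
  exists X : set nat, forall Y : set nat, turing_le X Y ->
    DgSp Y f = [set degree Y].

Definition intrinsically_ce_degree_on_cone (f : nat -> nat) : Prop :=
  exists X : set nat, forall Y : set nat, turing_le X Y ->
    forall d, DgSp Y f d -> exists2 A, ce_in A Y & d = degree (join A Y).

(** * Block functions *)

Definition nitv (a b : nat) : set nat := [set n | a <= n <= b].

Definition closed_itv (f : nat -> nat) (I : set nat) : Prop :=
  [/\ exists a b, I = nitv a b, f @` I `<=` I & f @^-1` I `<=` I].

Definition block_function (f : nat -> nat) : Prop :=
  forall n, exists2 I, closed_itv f I & I n.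

Definition block_of (f : nat -> nat) (n : nat) (B : set nat) : Prop :=
  [/\ closed_itv f B, B n
    & forall I, closed_itv f I -> I n -> B `<=` I].

Definition block (f : nat -> nat) (B : set nat) : Prop :=
  exists n, block_of f n B.

Definition embeds (f : nat -> nat) (B C : set nat) : Prop :=
  exists h : nat -> nat,
    [/\ set_fun B C h,
        set_inj B h,
        forall x y, B x -> B y -> x <= y -> h x <= h y
      & forall x, B x -> h (f x) = f (h x)].

Definition later (B C : set nat) : Prop :=
  forall x y, B x -> C y -> x < y.

(* Main.v *)
(** Call [c] a cut of [f] when [f] and its inverse preserve the initial segment
    below [c].  A cut [n] is rigid when the identity is the only strictly
    increasing map on [[0, n)] commuting with [f].

    If infinitely many blocks embed into no later block, then rigid cuts are
    unbounded: a non-trivial increasing map commuting with [f] below the next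
    cut would carry such a block into a later one.  Given a copy, a finite
    increasing sequence on which the transported [f] looks like [f] below a
    rigid cut must be an initial segment, so the transported [f] computes the
    isomorphism with the natural numbers, which has the c.e. degree of the set
    of pairs [(x, k)] with [k] at most the rank of [x].

    If only finitely many blocks embed into no later block, and [f] is not
    eventually the identity (otherwise it is intrinsically computable), a copy
    is built by finite initial segments.  Suppose that below some condition
    every condition extends to a copy whose graph [G] satisfies [G <= W (+) Y]
    and [W <= G (+) Y], where [W] is c.e. in [Y].  Take such a copy, and a long
    finite part of it.  Inserting finitely many elements shifts this part so
    that [G] changes at an element [x]; hence [W] changes below the use at [x],
    which enumerates some [z] into [W].  Inserting further elements moves the
    blocks of the part along embeddings into later blocks, so that [G] returns
    to its original values on that part and computes that [z] is not in [W],
    while the enumeration of [z] remains. *)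

Require Import Defs.
From mathcomp Require Import all_boot classical_sets functions cardinality.
From mathcomp Require Import boolp zify.
From Stdlib Require Cantor.

Set Implicit Arguments.
Unset Strict Implicit.
Unset Printing Implicit Defensive.

Local Open Scope classical_set_scope.

(** * Relative computability *)

Lemma nfst_pair a b : nfst (npair a b) = a.
Proof. by rewrite /nfst /npair Cantor.cancel_of_to. Qed.

Lemma nsnd_pair a b : nsnd (npair a b) = b.
Proof. by rewrite /nsnd /npair Cantor.cancel_of_to. Qed.

Lemma npairK n : npair (nfst n) (nsnd n) = n.
Proof. by rewrite /npair /nfst /nsnd -surjective_pairing Cantor.cancel_to_of. Qed.

Definition npairE := (nfst_pair, nsnd_pair, npairK).

Lemma nfst_le n : nfst n <= n.
Proof.
by rewrite -{2}(npairK n); have := Cantor.to_nat_non_decreasing (nfst n) (nsnd n); rewrite /npair; lia.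
Qed.

Lemma nsnd_le n : nsnd n <= n.
Proof.
by rewrite -{2}(npairK n); have := Cantor.to_nat_non_decreasing (nfst n) (nsnd n); rewrite /npair; lia.
Qed.

Lemma computes_inj X p n v w : computes X p n v -> computes X p n w -> v = w.
Proof.
elim: p n v w => [|||||p IHp q IHq|p IHp q IHq|p IHp q IHq|p IHp] n v w /=;
  try by move=> -> ->.
- by move=> [[? ->]|[? ->]] [[? ->]|[? ->]].
- move=> [a [b [pa qb ->]]] [c [d [pc qd ->]]].
  by rewrite (IHp _ _ _ pa pc) (IHq _ _ _ qb qd).
- move=> [m qm pv] [m' qm' pw].
  by move: pw; rewrite -(IHq _ _ _ qm qm') => /(IHp _ _ _ pv).
- elim: (nsnd n) v w => [|k IHk] v w /=; first exact: IHp.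
  move=> [u Ru qv] [u' Ru' qw].
  by move: qw; rewrite -(IHk _ _ Ru Ru') => /(IHq _ _ _ qv).
- move=> [pv minv] [pw minw].
  have [vw|wv|//] := ltngtP v w.
  + by have [u pu] := minw _ vw; have := IHp _ _ _ pv pu.
  + by have [u pu] := minv _ wv; have := IHp _ _ _ pw pu.
Qed.

Lemma bounded_choice (P : nat -> nat -> Prop) n :
  (forall m a b, a <= b -> P m a -> P m b) ->
  (forall m, m < n -> exists u, P m u) -> exists u, forall m, m < n -> P m u.
Proof.
move=> mono; elim: n => [|n IHn] ex; first by exists 0.
have [m mn|u Pu] := IHn; first by apply: ex; lia.
have [u' Pu'] := ex n (ltnSn n).
exists (maxn u u') => m; rewrite ltnS leq_eqVlt => /predU1P[->|mn].
  by apply: mono Pu'; lia.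
by apply: mono (Pu _ mn); lia.
Qed.

Definition agree u (X X' : set nat) := forall m, m < u -> (X m <-> X' m).

Lemma agree_le u u' X X' : u <= u' -> agree u' X X' -> agree u X X'.
Proof. by move=> uu' XX' m mu; apply: XX'; apply: leq_trans uu'. Qed.

Lemma computes_use X p n v : computes X p n v ->
  exists u, forall X', agree u X X' -> computes X' p n v.
Proof.
elim: p n v => [|||||p IHp q IHq|p IHp q IHq|p IHp q IHq|p IHp] n v /=;
  try by exists 0.
- move=> Xn; exists n.+1 => X' XX'; have [? ?] := XX' n (ltnSn n).
  by case: Xn => -[Xn ->]; [left|right]; split=> //; tauto.
- move=> [a [b [/IHp[u1 H1] /IHq[u2 H2] ->]]].
  exists (maxn u1 u2) => X' XX'; exists a, b; split=> //.
    by apply/H1/(agree_le _ XX'); lia.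
  by apply/H2/(agree_le _ XX'); lia.
- move=> [m /IHq[u1 H1] /IHp[u2 H2]].
  exists (maxn u1 u2) => X' XX'; exists m.
    by apply/H1/(agree_le _ XX'); lia.
  by apply/H2/(agree_le _ XX'); lia.
- elim: (nsnd n) v => [|k IHk] v /=; first exact: IHp.
  move=> [w /IHk[u1 H1] /IHq[u2 H2]].
  exists (maxn u1 u2) => X' XX'; exists w.
    by apply/H1/(agree_le _ XX'); lia.
  by apply/H2/(agree_le _ XX'); lia.
- move=> [/IHp[u1 H1] minv].
  pose P m u := exists w, forall X', agree u X X' -> computes X' p (npair n m) w.+1.
  have [m a b ab [w Hw]|m mv|u Hu] := @bounded_choice P v.
  + by exists w => X' XX'; apply/Hw/(agree_le ab).
  + by have [w /IHp[u Hu]] := minv m mv; exists u, w.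
  exists (maxn u1 u) => X' XX'; split.
    by apply/H1/(agree_le _ XX'); lia.
  by move=> m /Hu[w Hw]; exists w; apply/Hw/(agree_le _ XX'); lia.
Qed.

Fixpoint oracle_subst (r p : prog) : prog :=
  match p with
  | POracle => r
  | PPair p q => PPair (oracle_subst r p) (oracle_subst r q)
  | PComp p q => PComp (oracle_subst r p) (oracle_subst r q)
  | PRec p q => PRec (oracle_subst r p) (oracle_subst r q)
  | PMu p => PMu (oracle_subst r p)
  | p => p
  end.

Lemma computes_subst X Y r :
  (forall n, (X n -> computes Y r n 1) /\ (~ X n -> computes Y r n 0)) ->
  forall p, computes Y (oracle_subst r p) = computes X p.
Proof.
move=> rX; elim=> [|||||p IHp q IHq|p IHp q IHq|p IHp q IHq|p IHp] //=;
  rewrite ?IHp ?IHq //.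
apply/funext => n; apply/funext => v; apply/propext; have [r1 r0] := rX n.
split=> [rv|[[/r1 ? ->//]|[/r0 ? ->//]]].
have [/[dup] Xn /r1|/[dup] Xn /r0] := pselect (X n) => /(computes_inj rv) ->;
  by [left|right].
Qed.

Lemma turing_le_refl X : turing_le X X.
Proof. by exists POracle => n; split=> /= Xn; [left|right]. Qed.

Lemma turing_le_trans A X Y : turing_le A X -> turing_le X Y -> turing_le A Y.
Proof.
by move=> [p pA] [r rX]; exists (oracle_subst r p); rewrite (computes_subst rX).
Qed.

Lemma turing_equiv_refl A : turing_equiv A A.
Proof. by split; apply: turing_le_refl. Qed.

Lemma degree_eq A B : turing_equiv A B -> degree A = degree B.
Proof.
move=> [AB BA]; apply/seteqP; split=> C [] ? ?; split; eauto using turing_le_trans.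
Qed.

Definition computable (X : set nat) (F : nat -> nat) :=
  exists p, forall n, computes X p n (F n).

Lemma computable_comp X F G :
  computable X F -> computable X G -> computable X (fun n => F (G n)).
Proof. by move=> [p pF] [q qG]; exists (PComp p q) => n /=; exists (G n). Qed.

Lemma computable_pair X F G : computable X F -> computable X G ->
  computable X (fun n => npair (F n) (G n)).
Proof. by move=> [p pF] [q qG]; exists (PPair p q) => n /=; exists (F n), (G n). Qed.

Lemma computable_fst X F : computable X F -> computable X (fun n => nfst (F n)).
Proof. by apply: computable_comp; exists PFst. Qed.

Lemma computable_snd X F : computable X F -> computable X (fun n => nsnd (F n)).
Proof. by apply: computable_comp; exists PSnd. Qed.

Lemma computable_succ X F : computable X F -> computable X (fun n => (F n).+1).
Proof. by apply: computable_comp; exists PSucc. Qed.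

Lemma computable_id X : computable X id.
Proof.
by exists (PPair PFst PSnd) => n /=; exists (nfst n), (nsnd n); rewrite npairK.
Qed.

Lemma computable_const X c : computable X (fun=> c).
Proof. by elim: c => [|c /computable_succ//]; exists PZero. Qed.

Lemma computable_rec X F G H N :
  computable X F -> computable X N -> computable X G ->
  (forall n, H n = nat_rect (fun=> nat) (F n) (fun k u => G (npair n (npair k u))) (N n)) ->
  computable X H.
Proof.
move=> [p pF] N_comp [q qG] HE.
have [||r rH] := @computable_comp X
    (fun m => nat_rect (fun=> nat) (F (nfst m)) (fun k u => G (npair (nfst m) (npair k u))) (nsnd m))
    (fun n => npair n (N n)).
- exists (PRec p q) => m /=; elim: (nsnd m) => [|k IHk] /=; first exact: pF.
  by eexists; [exact: IHk|exact: qG].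
- exact: (@computable_pair X id N (@computable_id X) N_comp).
by exists r => n; have := rH n; rewrite !npairE HE.
Qed.

#[local] Hint Resolve computable_pair computable_fst computable_snd computable_succ
  computable_id computable_const : comp.

Lemma computable_case X C F G :
  computable X C -> computable X F -> computable X G ->
  computable X (fun n => if C n is 0 then F n else G n).
Proof.
move=> cC cF cG; apply: (@computable_rec X F (fun m => G (nfst m)) _ C) => //.
  by apply: computable_comp; auto with comp.
by move=> n; case: (C n) => //= k; rewrite npairE.
Qed.

Lemma turing_leP A X : turing_le A X <->
  exists2 F, computable X F & forall n, A n <-> F n != 0.
Proof.
split=> [[p pA]|[F [p pF] FA]].
  exists (fun n => `[< A n >] : nat).
    by exists p => n; case: asboolP => An; apply pA.
  by move=> n; case: asboolP.
have [q qG] : computable X (fun n => if F n is 0 then 0 else 1).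
  by apply: computable_case; [exists p| |]; auto with comp.
exists q => n; rewrite FA; have := qG n.
by case: (F n) => [|k] /= qn; split=> // -[].
Qed.

Lemma turing_le_preimage A X F :
  turing_le A X -> computable X F -> turing_le (fun n => A (F n)) X.
Proof.
move=> /turing_leP[G cG GA] cF; apply/turing_leP; exists (fun n => G (F n)) => //.
exact: computable_comp.
Qed.

Lemma turing_le_ext A B X : (forall n, B n <-> A n) -> turing_le A X -> turing_le B X.
Proof. by move=> BA; have -> // : A = B; apply/funext => n; apply/propext; have [] := BA n. Qed.

Lemma turing_le_not A X : turing_le A X -> turing_le (fun n => ~ A n) X.
Proof.
move=> /turing_leP[F cF FA]; apply/turing_leP.
exists (fun n => if F n is 0 then 1 else 0).
  by apply: computable_case; auto with comp.
by move=> n; rewrite FA; case: (F n) => [|k]; split=> // -[].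
Qed.

Lemma turing_le_and A B X :
  turing_le A X -> turing_le B X -> turing_le (fun n => A n /\ B n) X.
Proof.
move=> /turing_leP[F cF FA] /turing_leP[G cG GB]; apply/turing_leP.
exists (fun n => if F n is 0 then 0 else G n).
  by apply: computable_case; auto with comp.
by move=> n; rewrite FA GB; case: (F n) => [|k]; intuition.
Qed.

Lemma turing_le_or A B X :
  turing_le A X -> turing_le B X -> turing_le (fun n => A n \/ B n) X.
Proof.
move=> /turing_leP[F cF FA] /turing_leP[G cG GB]; apply/turing_leP.
exists (fun n => if F n is 0 then G n else 1).
  by apply: computable_case; auto with comp.
by move=> n; rewrite FA GB; case: (F n) => [|k]; intuition.
Qed.

Lemma turing_le_ball A N X : turing_le A X -> computable X N ->
  turing_le (fun n => forall j, j < N n -> A (npair n j)) X.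
Proof.
move=> /turing_leP[F cF FA] cN; apply/turing_leP.
exists (fun n => nat_rect (fun=> nat) 1
    (fun k u => if u is 0 then 0 else F (npair n k)) (N n)).
  apply: (@computable_rec X (fun=> 1)
      (fun m => if nsnd (nsnd m) is 0 then 0 else F (npair (nfst m) (nfst (nsnd m)))) _ N) => //;
    auto with comp.
    apply: computable_case; auto with comp.
    by apply: computable_comp; auto 10 with comp.
  move=> n; elim: (N n) => //= k ->.
  by rewrite !npairE.
move=> n; elim: (N n) => [//|k IHk] /=.
case: (nat_rect _ _ _ _) IHk => [|u] [IH1 IH2]; split.
- by move=> H; suff: 0 != 0 by []; apply: IH1 => j jk; apply: H; lia.
- by [].
- by move=> H; apply/FA/H.
- by move=> /FA Ak j; rewrite ltnS leq_eqVlt => /predU1P[->//|]; apply: IH2.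
Qed.

Lemma computable_pred X F : computable X F -> computable X (fun n => (F n).-1).
Proof.
move=> cF; apply: (@computable_rec X (fun=> 0) (fun m => nfst (nsnd m)) _ F);
  auto with comp.
by move=> n; case: (F n) => //= k; rewrite !npairE.
Qed.

Lemma computable_sub X F G :
  computable X F -> computable X G -> computable X (fun n => F n - G n).
Proof.
move=> cF cG; apply: (@computable_rec X F (fun m => (nsnd (nsnd m)).-1) _ G) => //.
  by apply: computable_pred; auto with comp.
by move=> n; elim: (G n) => [|k IHk] /=; rewrite ?subn0 // !npairE -IHk; lia.
Qed.

Lemma turing_le_leq X F G :
  computable X F -> computable X G -> turing_le (fun n => F n <= G n) X.
Proof.
move=> cF cG; apply: (@turing_le_ext (fun n => ~ (F n - G n != 0))) => [n|].
  by split; lia.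
by apply/turing_le_not/turing_leP; exists (fun n => F n - G n) => //; apply: computable_sub.
Qed.

Lemma turing_le_eq X F G :
  computable X F -> computable X G -> turing_le (fun n => F n = G n) X.
Proof.
move=> cF cG; apply: (@turing_le_ext (fun n => F n <= G n /\ G n <= F n)) => [n|].
  by split; lia.
by apply: turing_le_and; apply: turing_le_leq.
Qed.

Lemma computable_iter X G H : computable X G ->
  (forall n, H n.+1 = G (npair n (H n))) -> computable X H.
Proof.
move=> cG HS; apply: (@computable_rec X (fun=> H 0) (fun m => G (nsnd m)) _ id);
  auto with comp.
  by apply: computable_comp; auto with comp.
move=> n /=; elim: {1 3}n => //= k IHk.
by rewrite HS IHk npairE.
Qed.

Lemma computable_odd X : computable X (fun n => odd n : nat).
Proof.
apply: (@computable_iter X (fun m => 1 - nsnd m)) => [|n].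
  by apply: computable_sub; auto with comp.
by rewrite npairE /=; case: (odd n).
Qed.

Lemma computable_half X : computable X half.
Proof.
apply: (@computable_iter X
    (fun m => if (odd (nfst m) : nat) is 0 then nsnd m else (nsnd m).+1)) => [|n].
  apply: computable_case; auto with comp.
  by apply: (computable_comp (@computable_odd X)); auto with comp.
by rewrite !npairE /= uphalf_half; case: (odd n).
Qed.

Lemma computable_double X F : computable X F -> computable X (fun n => (F n).*2).
Proof.
move=> cF; apply: (@computable_rec X (fun=> 0) (fun m => (nsnd (nsnd m)).+2) _ F);
  auto with comp.
by move=> n; elim: (F n) => //= k IHk; rewrite doubleS IHk !npairE.
Qed.

Lemma join_even A B n : join A B n.*2 = A n.
Proof. by rewrite /join /= odd_double doubleK. Qed.

Lemma join_odd A B n : join A B n.*2.+1 = B n.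
Proof. by rewrite /join /= odd_double /= uphalf_double. Qed.

Lemma join_l A B : turing_le A (join A B).
Proof.
apply: (@turing_le_ext (fun n => join A B n.*2)) => [n|]; first by rewrite join_even.
apply: turing_le_preimage (@turing_le_refl _) _.
by apply: computable_double; auto with comp.
Qed.

Lemma join_r A B : turing_le B (join A B).
Proof.
apply: (@turing_le_ext (fun n => join A B n.*2.+1)) => [n|]; first by rewrite join_odd.
apply: turing_le_preimage (@turing_le_refl _) _.
by apply/computable_succ/computable_double; auto with comp.
Qed.

Lemma join_lub A B X : turing_le A X -> turing_le B X -> turing_le (join A B) X.
Proof.
move=> AX BX.
have odd_X : turing_le (fun n => odd n = 1 :> nat) X.
  by apply: turing_le_eq (@computable_odd X) _; auto with comp.
apply: (@turing_le_ext (fun n => (odd n = 1 :> nat /\ B n./2) \/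
    (~ odd n = 1 :> nat /\ A n./2))) => [n|].
  by rewrite /join /=; case: (odd n); intuition.
by apply: turing_le_or; apply: turing_le_and => //; try apply: turing_le_not => //;
  apply: turing_le_preimage => //; apply: computable_half.
Qed.

Definition sigma1 (A X : set nat) :=
  exists2 R, turing_le R X & forall n, A n <-> exists v, R (npair n v).

Lemma turing_le_sigma1 A X : turing_le A X -> sigma1 A X.
Proof.
move=> AX; exists (fun m => A (nfst m)).
  by apply: turing_le_preimage; auto with comp.
by move=> n; split=> [An|[v]]; [exists 0|]; rewrite npairE.
Qed.

Lemma least_witness (P : nat -> Prop) : (exists v, P v) ->
  exists2 v, P v & forall m, m < v -> ~ P m.
Proof.
move=> [v Pv].
have ex : exists v, `[< P v >] by exists v; apply/asboolP.
exists (ex_minn ex); case: ex_minnP => m /asboolP // _ min k km Pk.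
by have := min k (asboolT Pk); lia.
Qed.

Lemma sigma1_search R X : turing_le R X ->
  exists p, forall n v, computes X p n v <->
    R (npair n v) /\ forall m, m < v -> ~ R (npair n m).
Proof.
move=> /turing_le_not[p pR]; exists (PMu p) => n v /=; split.
  move=> [pv minv]; split.
    apply: contrapT => nR; have [p1 _] := pR (npair n v).
    by have := computes_inj pv (p1 nR).
  move=> m /minv[u pu] Rm; have [_ p0] := pR (npair n m).
  by have := computes_inj pu (p0 (fun f => f Rm)).
move=> [Rv minv]; split.
  by have [_ p0] := pR (npair n v); apply: p0.
by move=> m /minv nR; exists 0; have [p1 _] := pR (npair n m); apply: p1.
Qed.

Lemma sigma1_ce A X : sigma1 A X -> ce_in A X.
Proof.
move=> [R /sigma1_search[p pR] AR]; exists p => n; rewrite AR; split.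
  by move=> /least_witness[v Rv minv]; exists v; apply/pR.
by move=> [v /pR[Rv _]]; exists v.
Qed.

Lemma sigma1_preimage A X F :
  sigma1 A X -> computable X F -> sigma1 (fun n => A (F n)) X.
Proof.
move=> [R RX AR] cF; exists (fun m => R (npair (F (nfst m)) (nsnd m))).
  apply: turing_le_preimage => //; apply: computable_pair; auto with comp.
  by apply: computable_comp; auto with comp.
by move=> n; rewrite AR; split=> -[v Rv]; exists v; move: Rv; rewrite !npairE.
Qed.

Lemma sigma1_ext A B X : (forall n, B n <-> A n) -> sigma1 A X -> sigma1 B X.
Proof. by move=> BA; have -> // : A = B; apply/funext => n; apply/propext; have [] := BA n. Qed.

Lemma sigma1_ex A X : sigma1 A X -> sigma1 (fun n => exists v, A (npair n v)) X.
Proof.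
move=> [R RX AR].
exists (fun m => R (npair (npair (nfst m) (nfst (nsnd m))) (nsnd (nsnd m)))).
  by apply: turing_le_preimage => //; auto 10 with comp.
move=> n; split=> [[v /AR[w Rw]]|[v Rv]].
  by exists (npair v w); rewrite !npairE.
by move: Rv; rewrite !npairE => Rv; exists (nfst v); apply/AR; exists (nsnd v).
Qed.

Lemma sigma1_and A B X :
  sigma1 A X -> sigma1 B X -> sigma1 (fun n => A n /\ B n) X.
Proof.
move=> [R RX AR] [Q QX BQ].
exists (fun m => R (npair (nfst m) (nfst (nsnd m))) /\ Q (npair (nfst m) (nsnd (nsnd m)))).
  by apply: turing_le_and; apply: turing_le_preimage => //; auto 10 with comp.
move=> n; split=> [[/AR[v Rv] /BQ[w Qw]]|[v]].
  by exists (npair v w); rewrite !npairE.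
by rewrite !npairE => -[Rv Qw]; split; [apply/AR|apply/BQ]; eexists; eauto.
Qed.

Lemma sigma1_or A B X :
  sigma1 A X -> sigma1 B X -> sigma1 (fun n => A n \/ B n) X.
Proof.
move=> [R RX AR] [Q QX BQ]; exists (fun m => R m \/ Q m).
  exact: turing_le_or.
move=> n; rewrite AR BQ; split=> [[[v ?]|[v ?]]|[v [?|?]]].
- by exists v; left.
- by exists v; right.
- by left; exists v.
- by right; exists v.
Qed.

Lemma delta1_turing_le A X : sigma1 A X -> sigma1 (fun n => ~ A n) X -> turing_le A X.
Proof.
move=> [R RX AR] [Q QX AQ].
have [p pRQ] := sigma1_search (turing_le_or RX QX).
have total n : exists v, computes X p n v.
  suff /least_witness[v Rv minv] : exists v, R (npair n v) \/ Q (npair n v).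
    by exists v; apply/pRQ.
  have [/AR[v]|/AQ[v]] := pselect (A n); by exists v; auto.
have [F pF] := choice total.
apply: (@turing_le_ext (fun n => R (npair n (F n)))).
  move=> n; split=> [An|]; last by move=> ?; apply/AR; eexists; eauto.
  have /pRQ[[//|Qn] _] := pF n.
  by have /AQ : exists v, Q (npair n v) by eexists; eauto.
by apply: turing_le_preimage => //; apply: computable_pair; auto with comp; exists p.
Qed.

Lemma turing_le_finite_variant A B X N :
  (forall n, N <= n -> (A n <-> B n)) -> turing_le A X -> turing_le B X.
Proof.
elim: N B => [|N IHN] B AB AX; first by apply: turing_le_ext AX => n; rewrite AB.
have CX : turing_le (fun n => if n == N then A n else B n) X.
  apply: (IHN _ _ AX) => n Nn.
  by have [//|nN] := eqVneq n N; apply: AB; lia.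
have eqN : turing_le (fun n => n = N) X by apply: turing_le_eq; auto with comp.
have [BN|nBN] := pselect (B N).
  refine (turing_le_ext _ (turing_le_or eqN CX)) => n.
  by case: eqP => [->|nN]; tauto.
refine (turing_le_ext _ (turing_le_and (turing_le_not eqN) CX)) => n.
by case: eqP => [->|nN]; tauto.
Qed.

(* The sequence coded by [s] is [nfst s, nfst (nsnd s), nfst (nsnd (nsnd s)), ...]. *)
Definition sget (s j : nat) : nat := nfst (iter j nsnd s).

Lemma computable_sget X F G :
  computable X F -> computable X G -> computable X (fun n => sget (F n) (G n)).
Proof.
move=> cF cG; apply: computable_fst.
apply: (@computable_rec X F (fun m => nsnd (nsnd (nsnd m))) _ G); auto with comp.
by move=> n; elim: (G n) => //= k ->; rewrite !npairE.
Qed.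

Lemma sget_surj k (g : nat -> nat) : exists s, forall j, j < k -> sget s j = g j.
Proof.
elim: k g => [|k IHk] g; first by exists 0.
have [s sg] := IHk (fun j => g j.+1).
exists (npair (g 0) s) => -[|j] jk; first by rewrite /sget /= npairE.
by rewrite /sget iterSr npairE; apply: sg.
Qed.

Lemma prog_countable : exists e : nat -> prog, forall p, exists n, e n = p.
Proof.
pose fix code (p : prog) : nat :=
  match p with
  | PZero => npair 0 0 | PSucc => npair 1 0 | PFst => npair 2 0
  | PSnd => npair 3 0 | POracle => npair 4 0
  | PPair p q => npair 5 (npair (code p) (code q))
  | PComp p q => npair 6 (npair (code p) (code q))
  | PRec p q => npair 7 (npair (code p) (code q))
  | PMu p => npair 8 (code p)
  end.
have npair_inj a b c d : npair a b = npair c d -> a = c /\ b = d.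
  by move=> E; rewrite -(nfst_pair a b) -{2}(nsnd_pair a b) E !npairE.
have code_inj : injective code.
  elim=> [|||||p IHp q IHq|p IHp q IHq|p IHp q IHq|p IHp] [] //=;
    try by [move=> > /npair_inj[] | move=> /npair_inj[]].
  - by move=> ? ? /npair_inj[_ /npair_inj[/IHp -> /IHq ->]].
  - by move=> ? ? /npair_inj[_ /npair_inj[/IHp -> /IHq ->]].
  - by move=> ? ? /npair_inj[_ /npair_inj[/IHp -> /IHq ->]].
  - by move=> ? /npair_inj[_ /IHp ->].
have [n|e eP] := @choice _ _ (fun n p => forall q, code q = n -> p = q).
  have [[p <-]|none] := pselect (exists p, code p = n).
    by exists p => q /code_inj.
  by exists PZero => q qn; case: none; exists q.
by exists e => p; exists (code p); apply: eP.
Qed.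

(** * Blocks, cuts and embeddings *)

Lemma closed_itvE f I : closed_itv f I <->
  (exists a b, I = nitv a b) /\ forall x, I x <-> I (f x).
Proof.
split=> [[itv_I im_I pre_I]|[itv_I I_f]].
  by split=> // x; split=> Ix; [apply: im_I; exists x|apply: pre_I].
split=> // [_ [x Ix <-]|x Ifx]; first exact/(I_f x).
exact/(I_f x).
Qed.

Lemma convex_nitv (J : set nat) m b : J m -> (forall x, J x -> x <= b) ->
  (forall x y z, J x -> J z -> x <= y <= z -> J y) -> exists a b, J = nitv a b.
Proof.
move=> Jm Jb convJ.
have ex : exists x, `[< J x >] by exists m; apply/asboolP.
have [l /asboolP Jl minl] := ex_minnP ex.
have [x /asboolP /Jb //|r /asboolP Jr maxr] := ex_maxnP ex (m := b).
exists l, r; apply/seteqP; split=> [x Jx|x /(convJ l x r)]; last by apply.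
by rewrite /nitv /= minl ?maxr //; apply/asboolP.
Qed.

Lemma nitv_convex I x y z : (exists a b, I = nitv a b) ->
  I x -> I z -> x <= y <= z -> I y.
Proof. by move=> [a [b ->]]; rewrite /nitv /=; lia. Qed.

Lemma block_of_exists f : block_function f -> forall n, exists B, block_of f n B.
Proof.
move=> f_block n; exists [set x | forall I, closed_itv f I -> I n -> I x].
split=> // [|I cI In x]; last exact.
apply/closed_itvE; split=> [|x]; last first.
  by split=> Ix I /[dup] cI /closed_itvE[_ fI] In; apply/(fI x)/(Ix I cI In).
have [I /[dup] cI /closed_itvE[[a [b Iab]] _] In] := f_block n.
apply: (@convex_nitv _ n b) => [//|x /(_ I cI In)|x y z Jx Jz xyz J /[dup] cJ].
  by rewrite Iab /nitv /=; lia.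
by move=> /closed_itvE[itvJ _] Jn; apply: (nitv_convex itvJ (Jx J cJ Jn) (Jz J cJ Jn)).
Qed.

Lemma block_of_uniq f n B C : block_of f n B -> block_of f n C -> B = C.
Proof.
by move=> [cB Bn minB] [cC Cn minC]; apply/seteqP; split; [apply: minB|apply: minC].
Qed.

Lemma block_of_image f m B h I : block_of f m B ->
  (forall x y, B x -> B y -> x <= y -> h x <= h y) ->
  (forall x, B x -> h (f x) = f (h x)) ->
  closed_itv f I -> I (h m) -> forall x, B x -> I (h x).
Proof.
move=> [/closed_itvE[itvB fB] Bm minB] mono comm /closed_itvE[itvI fI] Ihm x Bx.
suff : B `<=` [set x | B x /\ I (h x)] by move=> /(_ x Bx)[].
apply: minB => //; apply/closed_itvE; split=> [|y]; last first.
  split=> [[By Ihy]|[/(fB y) By]].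
    by split; [apply/(fB y)|rewrite comm //; apply/(fI (h y))].
  by rewrite comm // => /(fI (h y)).
have [a [b Bab]] := itvB.
apply: (@convex_nitv _ m b) => // [y [+ _]|y z w [By Ihy] [Bw Ihw] yzw].
  by rewrite Bab /nitv /=; lia.
have Bz : B z by apply: (nitv_convex itvB By Bw).
by split=> //; apply: (nitv_convex itvI Ihy Ihw); rewrite !mono //; lia.
Qed.

(* Blocks may be nested: the block of [n] is the least closed interval
   containing [n], and it may lie strictly inside the block of another point.
   The outermost blocks are the intervals between consecutive cuts. *)
Definition cut (f : nat -> nat) (c : nat) := forall x, (x < c) = (f x < c).

Lemma cut_closed_itv f a b : cut f a -> cut f b.+1 -> closed_itv f (nitv a b).
Proof.
move=> cut_a cut_b; apply/closed_itvE; split=> [|x]; first by exists a, b.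
by have := cut_a x; have := cut_b x; rewrite /nitv /=; lia.
Qed.

Lemma cut0 f : cut f 0. Proof. by []. Qed.

Lemma cut_unbounded f : block_function f -> forall m, exists2 c, m < c & cut f c.
Proof.
move=> f_block.
have next c : cut f c -> exists2 c', c < c' & cut f c'.
  move=> cut_c; have [I /closed_itvE[[a [b ->]] fI]] := f_block c.
  rewrite /nitv /= => cab; exists b.+1; first by lia.
  by move=> x; have := cut_c x; have := fI x; rewrite /nitv /=; lia.
elim=> [|m [c mc cut_c]]; first exact: next (@cut0 f).
have [mc'|cm] := ltnP m.+1 c; first by exists c.
have -> : m.+1 = c by lia.
exact: next.
Qed.

Lemma block_below_cut f n : block_function f -> cut f n -> 0 < n ->
  exists a, [/\ a < n, cut f a & block_of f n.-1 (nitv a n.-1)].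
Proof.
move=> f_block cut_n n0; have [B blockB] := block_of_exists f_block n.-1.
have [/closed_itvE[[a [b Bab]] fB] Bn minB] := blockB.
have bn : b = n.-1.
  have := minB (nitv 0 n.-1); rewrite {}Bab /nitv /= in Bn *.
  move=> /(_ _ _ b) /=; have := @cut_closed_itv f 0 n.-1 (@cut0 f).
  by rewrite (ltn_predK n0) => /(_ cut_n) c0 /(_ c0); lia.
rewrite {}Bab {}bn in fB Bn blockB *.
exists a; split=> //; first by move: Bn; rewrite /nitv /=; lia.
by move=> x; have := fB x; have := cut_n x; move: Bn; rewrite /nitv /=; lia.
Qed.

Definition strict_mono_below (h : nat -> nat) (n : nat) :=
  forall i j, i < j -> j < n -> h i < h j.

Definition commutes_below (f h : nat -> nat) (n : nat) :=
  forall j, j < n -> h (f j) = f (h j).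

Lemma strict_mono_below_ge h n j : strict_mono_below h n -> j < n -> j <= h j.
Proof.
move=> mono; elim: j => // j IHj jn.
by have := mono j j.+1 (ltnSn j) jn; have := IHj (ltnW jn); lia.
Qed.

Lemma strict_mono_below_id h n : strict_mono_below h n -> h n.-1 <= n.-1 ->
  forall j, j < n -> h j = j.
Proof.
move=> mono hn j jn; apply/eqP; rewrite eqn_leq (strict_mono_below_ge mono jn) andbT.
suff : forall k, k < n -> h (n.-1 - k) <= n.-1 - k.
  by move=> /(_ (n.-1 - j)); rewrite subKn; [apply; lia|lia].
elim=> [|k IHk] kn; first by rewrite subn0.
by have := mono (n.-1 - k.+1) (n.-1 - k); have := IHk (ltnW kn); lia.
Qed.

Definition rigid (f : nat -> nat) (n : nat) :=
  forall h, strict_mono_below h n -> commutes_below f h n ->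
  forall j, j < n -> h j = j.

Definition isolated_blocks (f : nat -> nat) : set (set nat) :=
  [set B | block f B /\ ~ exists C, [/\ block f C, later B C & embeds f B C]].

Lemma rigid_unbounded f : block_function f -> infinite_set (isolated_blocks f) ->
  forall M, exists n, [/\ M < n, cut f n & rigid f n].
Proof.
move=> f_block inf_S M.
have [m [B [Mm blockB isoB]]] : exists m B, [/\ M <= m, block_of f m B &
    ~ exists C, [/\ block f C, later B C & embeds f B C]].
  apply: contrapT => none; apply: inf_S.
  have [blk blkP] := choice (block_of_exists f_block).
  apply: (@sub_finite_set _ _ (blk @` `I_M)); last exact/finite_image/finite_II.
  move=> B [[m blockB] isoB]; exists m; last exact: block_of_uniq (blkP m) blockB.
  by rewrite /= ltnNge; apply/negP => Mm; apply: none; exists m, B.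
have ex : exists c, (m < c) && `[< cut f c >].
  have [c mc cut_c] := cut_unbounded f_block m.
  by exists c; rewrite mc; apply/asboolP.
have [n /andP[mn /asboolP cut_n] minn] := ex_minnP ex.
exists n; split=> //; first by lia.
move=> h mono comm.
have [hn|nh] := leqP (h n.-1) n.-1; first exact: strict_mono_below_id.
have mono' x y : y < n -> x <= y -> h x <= h y.
  by move=> yn; rewrite leq_eqVlt => /predU1P[->//|xy]; apply/ltnW/mono.
have [|a [an cut_a block_a]] := block_below_cut f_block cut_n; first by lia.
have am : a <= m.
  by rewrite leqNgt; apply/negP => ma; have := minn a; rewrite ma asboolT //=; lia.
case: isoB.
have blockI k J : closed_itv f J -> J k -> forall I, block_of f k I -> I `<=` J.
  by move=> cJ Jk I [_ _]; apply.
have Bn x : B x -> x < n.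
  have := blockI m (nitv 0 n.-1) _ _ _ blockB; rewrite /nitv => Bn /Bn /=.
  move=> /(_ (@cut_closed_itv f 0 n.-1 (@cut0 f) _)).
  by rewrite (ltn_predK mn) => /(_ cut_n); lia.
have far : n <= h m.
  have [b hb cut_b] := cut_unbounded f_block (h n.-1).
  have : nitv n b.-1 (h m).
    apply: (block_of_image block_a (h := h)) => [x y ax ay|x ax||/=|/=].
    - by apply: mono'; move: ay; rewrite /nitv /=; lia.
    - by apply: comm; move: ax; rewrite /nitv /=; lia.
    - by apply: cut_closed_itv => //; rewrite (ltn_predK hb).
    - by rewrite /nitv /=; lia.
    - by rewrite /nitv /=; lia.
  by rewrite /nitv /=; lia.
have [C blockC] := block_of_exists f_block (h m).
have [c hc cut_c] := cut_unbounded f_block (h m).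
exists C; split; first by exists (h m).
  move=> x y /Bn xn Cy; suff : nitv n c.-1 y by rewrite /nitv /=; lia.
  apply: (blockI (h m)) Cy => //; last by rewrite /nitv /=; lia.
  by apply: cut_closed_itv => //; rewrite (ltn_predK hc).
have [cC Cm _] := blockC.
exists h; split.
- move=> x Bx; apply: (block_of_image blockB (h := h)) => // [y z By Bz|y By].
    by apply: mono'; apply: Bn.
  by apply: comm; apply: Bn.
- move=> x y /set_mem/Bn xn /set_mem/Bn yn hxy.
  by have [/mono|/mono|//] := ltngtP x y => /(_ ltac:(assumption)); rewrite hxy ltnn.
- by move=> x y Bx /Bn; apply: mono'.
- by move=> x /Bn; apply: comm.
Qed.

Lemma finite_blocks_bounded f : finite_set (isolated_blocks f) ->
  exists N, forall B, isolated_blocks f B -> forall x, B x -> x < N.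
Proof.
move=> /finite_seqP[s sE].
have [N HN] : exists N, forall B, B \in s -> block f B -> forall x, B x -> x < N.
  elim: s {sE} => [|B s [N HN]]; first by exists 0.
  have [blockB|nblockB] := pselect (block f B); last first.
    by exists N => C; rewrite inE => /predU1P[->//|]; apply: HN.
  have [m [/closed_itvE[[a [b Bab]] _] _ _]] := blockB.
  exists (maxn N b.+1) => C; rewrite inE => /predU1P[->|Cs] blockC x.
    by rewrite Bab /nitv /=; lia.
  by move=> /(HN C Cs blockC); lia.
exists N => B SB; apply: HN; last by case: SB.
by move: SB; rewrite sE.
Qed.

Lemma embeds_trans f B C D : closed_itv f B ->
  embeds f B C -> embeds f C D -> embeds f B D.
Proof.
move=> /closed_itvE[_ fB] [h [hC h_inj h_mono h_comm]] [k [kD k_inj k_mono k_comm]].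
exists (k \o h); split=> [x Bx|x y Bx By|x y Bx By xy|x Bx] /=.
- by apply/kD/hC.
- move=> /k_inj kE; apply: h_inj => //; apply: kE; apply/mem_set/hC; exact: set_mem.
- by apply: k_mono; [apply: hC|apply: hC|apply: h_mono].
- by rewrite h_comm // k_comm //; apply: hC.
Qed.

Lemma embeds_refl f B : embeds f B B.
Proof. by exists id; split=> // x y _ _. Qed.

Lemma embeds_far f N :
  (forall B, isolated_blocks f B -> forall x, B x -> x < N) ->
  forall K B, block f B -> (forall x, B x -> N <= x) ->
  exists C, [/\ block f C, embeds f B C & forall x, C x -> N <= x /\ K <= x].
Proof.
move=> isoN K B blockB BN; elim: K => [|K [C [blockC BC CNK]]].
  by exists B; split=> // [|x /BN //]; apply: embeds_refl.
have [m [cB Bm _]] := blockB; have [k [cC Ck _]] := blockC.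
have [Ck_N Ck_K] := CNK k Ck.
have [D [blockD CD embD]] : exists D, [/\ block f D, later C D & embeds f C D].
  apply: contrapT => none; have /isoN/(_ k Ck) : isolated_blocks f C by [].
  by lia.
exists D; split=> // [|x Dx]; first exact: embeds_trans embD.
by have := CD k x Ck Dx; lia.
Qed.

Lemma cut_embedding f N : block_function f -> cut f N ->
  (forall B, isolated_blocks f B -> forall x, B x -> x < N) ->
  forall K n, cut f n -> N <= n -> exists h,
    [/\ forall j, j < N -> h j = j, strict_mono_below h n, commutes_below f h n
      & forall j, N <= j < n -> K <= h j].
Proof.
move=> f_block cut_N isoN K; elim/ltn_ind=> n IHn cut_n Nn.
have [nN|Nn'] := leqP n N.
  by exists id; split=> // j; lia.
have [|a [an cut_a block_a]] := block_below_cut f_block cut_n; first by lia.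
have Na : N <= a.
  have [_ _ /(_ (nitv N n.-1))] := block_a; move=> /(_ _ _ a); rewrite /nitv /=.
  move=> H; apply: (proj1 (andP (H _ _ _))); try by lia.
  by apply: cut_closed_itv => //; rewrite (ltn_predK Nn').
have [h [h_id h_mono h_comm h_K]] := IHn a an cut_a Na.
pose B := nitv a n.-1; pose K' := maxn K (h a.-1).+1.
have [||C [blockC [e [e_C e_inj e_mono e_comm]] C_K]] := @embeds_far f N isoN K' B.
- by exists n.-1.
- by move=> x; rewrite /B /nitv /=; lia.
have BE x : a <= x < n -> B x by rewrite /B /nitv /=; lia.
have eK x : a <= x < n -> K' <= e x by move=> /BE/e_C/C_K[].
exists (fun j => if j < a then h j else e j); split=> [j jN|i j ij jn|j jn|j Njn].
- by rewrite ifT ?h_id //; lia.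
- case: (ltnP j a) => ja; first by rewrite ifT ?h_mono //; lia.
  case: (ltnP i a) => ia.
    have := eK j; rewrite ja jn /K' => /(_ isT).
    have [->|ia'] := eqVneq i a.-1; first by lia.
    by have := h_mono i a.-1; lia.
  rewrite ltn_neqAle e_mono ?andbT //; try (by apply: BE; lia); last by lia.
  by apply/eqP => /e_inj ijE; have := ltnn i; rewrite {2}ijE ?ij //;
    apply/mem_set/BE; lia.
- rewrite -cut_a; case: (ltnP j a) => ja; first exact: h_comm.
  by rewrite e_comm //; apply: BE; lia.
- case: (ltnP j a) => ja; first by apply: h_K; lia.
  by have := eK j; rewrite /K'; lia.
Qed.

Lemma shift_breaks f i : block_function f -> f i <> i ->
  exists d, f (i + d) <> f i + d.
Proof.
move=> f_block fi; apply: contrapT => none.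
have f_shift d : f (i + d) = f i + d by apply: contrapT => fd; apply: none; exists d.
have [c ic cut_c] := cut_unbounded f_block i.
have [f_lt|f_gt|//] := ltngtP (f i) i.
  by have := cut_c (i + (c - i)); rewrite f_shift; lia.
by have := cut_c (i + (c.-1 - i)); rewrite f_shift; lia.
Qed.

(** * A copy that is not of c.e. degree *)

Definition pullback_lt (pi : nat -> nat) : set nat := code_rel (fun x y => pi x < pi y).

Definition pullback_graph (f pi : nat -> nat) : set nat :=
  code_rel (transport_graph f setT pi).

Lemma agree_join u A A' B B' :
  agree u A A' -> agree u B B' -> agree u (join A B) (join A' B').
Proof.
move=> AA' BB' m mu; have mu' : m./2 < u by lia.
by rewrite /join /=; case: (odd m); [apply: BB'|apply: AA'].
Qed.

Lemma agree_refl u A : agree u A A. Proof. by []. Qed.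

Lemma pullback_shift (g1 pi1 g2 pi2 h : nat -> nat) n x :
  cancel pi1 g1 -> cancel g2 pi2 -> (forall j, j < n -> g2 (h j) = g1 j) ->
  pi1 x < n -> pi2 x = h (pi1 x).
Proof. by move=> g1K pi2K gh /gh; rewrite g1K => E; rewrite -{1}E pi2K. Qed.

Lemma strict_mono_below_lt h n i j : strict_mono_below h n -> i < n -> j < n ->
  (h i < h j) = (i < j).
Proof.
move=> mono i_n j_n; have [ij|ji|->] := ltngtP i j; last by rewrite ltnn.
  by rewrite mono.
by have := mono j i ji i_n; lia.
Qed.

Lemma strict_mono_below_inj h n i j : strict_mono_below h n -> i < n -> j < n ->
  h i = h j -> i = j.
Proof.
move=> mono i_n j_n hij; have [ij|ji|//] := ltngtP i j.
  by have := mono i j ij j_n; rewrite hij ltnn.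
by have := mono j i ji i_n; rewrite hij ltnn.
Qed.

Lemma agree_pullback_lt u g1 pi1 g2 pi2 h n :
  cancel pi1 g1 -> cancel g2 pi2 -> strict_mono_below h n ->
  (forall j, j < n -> g2 (h j) = g1 j) -> (forall x, x < u -> pi1 x < n) ->
  agree u (pullback_lt pi1) (pullback_lt pi2).
Proof.
move=> g1K pi2K mono gh un m mu; rewrite /pullback_lt /code_rel /=.
have x_n : pi1 (nfst m) < n by apply/un/(leq_ltn_trans (nfst_le m)).
have y_n : pi1 (nsnd m) < n by apply/un/(leq_ltn_trans (nsnd_le m)).
by rewrite !(pullback_shift g1K pi2K gh) // (strict_mono_below_lt mono).
Qed.

Lemma agree_pullback_graph f u g1 pi1 g2 pi2 h n :
  cancel pi1 g1 -> cancel g2 pi2 -> strict_mono_below h n ->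
  commutes_below f h n -> cut f n ->
  (forall j, j < n -> g2 (h j) = g1 j) -> (forall x, x < u -> pi1 x < n) ->
  agree u (pullback_graph f pi1) (pullback_graph f pi2).
Proof.
move=> g1K pi2K mono comm cut_n gh un m mu.
rewrite /pullback_graph /code_rel /transport_graph /=.
have x_n : pi1 (nfst m) < n by apply/un/(leq_ltn_trans (nfst_le m)).
have y_n : pi1 (nsnd m) < n by apply/un/(leq_ltn_trans (nsnd_le m)).
have fx_n : f (pi1 (nfst m)) < n by rewrite -cut_n.
rewrite !(pullback_shift g1K pi2K gh) // -comm //.
split=> -[_ _ E]; split=> //; first by rewrite E.
exact: (strict_mono_below_inj mono).
Qed.

Lemma insertion (g h : nat -> nat) m :
  (forall i j, i < m -> j < m -> g i = g j -> i = j) -> strict_mono_below h m ->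
  exists2 g', injective g' & forall j, j < m -> g' (h j) = g j.
Proof.
move=> g_inj mono.
have [M gM] : exists M, forall j, j < m -> g j < M.
  by apply: bounded_choice => [j a b|j jm]; [lia|exists (g j).+1].
have [p|g' g'P] := @choice _ _ (fun p v => (exists2 j, j < m & h j = p /\ v = g j) \/
    (~ (exists2 j, j < m & h j = p) /\ v = M + p)).
  have [[j jm hj]|none] := pselect (exists2 j, j < m & h j = p).
    by exists (g j); left; exists j.
  by exists (M + p); right.
exists g' => [p q|j jm].
  case: (g'P p) => [[j jm [<- ->]]|[_ ->]]; case: (g'P q) => [[k km [<- ->]]|[_ ->]].
  - by move=> /g_inj ->.
  - by have := gM j jm; lia.
  - by have := gM k km; lia.
  - lia.
case: (g'P (h j)) => [[k km [hk ->]]|[[]]]; last by exists j.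
by congr g; apply: (strict_mono_below_inj mono).
Qed.

Definition reduces (p : prog) (A X : set nat) :=
  forall n, (A n -> computes X p n 1) /\ (~ A n -> computes X p n 0).

Definition domain (e : prog) (X : set nat) : set nat :=
  [set z | exists v, computes X e z v].

(* [p], [q] and [e] witness that the copy given by [pi] has the degree of a set
   c.e. in [Y]. *)
Definition ce_degree_via (f : nat -> nat) (X : set nat) (p q e : prog)
    (pi : nat -> nat) :=
  let Y := join X (pullback_lt pi) in
  reduces p (join (pullback_graph f pi) Y) (join (domain e Y) Y) /\
  reduces q (join (domain e Y) Y) (join (pullback_graph f pi) Y).

Lemma image_bound (F : nat -> nat) u : exists b, forall x, x < u -> F x < b.
Proof.
by apply: bounded_choice => [j a b|j _]; [lia|exists (F j).+1].
Qed.

(* A condition [(g, n)] describes the first [n] elements of the copy, [g j] being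
   the element in position [j]. *)
Lemma diagonal_step f N0 X p q e : block_function f ->
  (forall B, isolated_blocks f B -> forall x, B x -> x < N0) ->
  (forall N, exists2 i, N <= i & f i <> i) ->
  forall g0 n0, injective g0 -> exists g1 n1,
  [/\ injective g1, n0 <= n1, forall j, j < n0 -> g1 j = g0 j
    & forall g pi, cancel g pi -> cancel pi g ->
      (forall j, j < n1 -> g j = g1 j) -> ~ ce_degree_via f X p q e pi].
Proof.
move=> f_block isoN0 moved g0 n0 g0_inj; apply: contrapT => none.
have dense g1 n1 : injective g1 -> n0 <= n1 -> (forall j, j < n0 -> g1 j = g0 j) ->
    exists g pi, [/\ cancel g pi, cancel pi g, forall j, j < n1 -> g j = g1 j
      & ce_degree_via f X p q e pi].
  move=> g1_inj n01 g1g0; apply: contrapT => no_copy; apply: none.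
  exists g1, n1; split=> // g pi gK piK gg1 via; apply: no_copy.
  by exists g, pi.
have [N N_gt cut_N] := cut_unbounded f_block (maxn N0 n0).
have isoN B : isolated_blocks f B -> forall x, B x -> x < N.
  by move=> SB x /(isoN0 B SB); lia.
have [i Ni fi] := moved N.
have [d fd] := shift_breaks f_block fi.
have [||g1 [pi1 [g1K pi1K g1g0 [red1 redA1]]]] := dense g0 N g0_inj; [lia|by []|].
set Y1 := join X _ in red1 redA1; set G1 := pullback_graph f pi1 in red1 redA1.
pose m := npair (g1 i) (g1 (f i)).
have [u u_use] : exists u, forall X', agree u (join (domain e Y1) Y1) X' ->
    computes X' p m.*2 1.
  have [+ _] := red1 m.*2; rewrite join_even => H; apply/computes_use/H.
  by rewrite /G1 /pullback_graph /code_rel /= /m !npairE; split; rewrite ?g1K.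
have [u' u'_use] : exists u', forall z, z < u ->
    (domain e Y1 z -> forall X', agree u' Y1 X' -> domain e X' z) /\
    (~ domain e Y1 z -> forall X', agree u' (join G1 Y1) X' -> computes X' q z.*2 0).
  apply: bounded_choice => [z a b ab [H1 H0]|z _].
    by split=> Wz X' agr; [apply: H1|apply: H0] => //; apply: agree_le ab agr.
  have [[v /computes_use[w Hw]]|nWz] := pselect (domain e Y1 z).
    exists w; split=> [_ X' /Hw ?|[]]; first by exists v.
    by exists v; apply: Hw.
  have [_] := redA1 z.*2; rewrite join_even => /(_ nWz) /computes_use[w Hw].
  by exists w; split=> // _.
have [b1 pi1_b] := image_bound pi1 (maxn u u').
have [n n_gt cut_n] := cut_unbounded f_block (maxn (maxn N i) b1).
have pi1_n x : x < maxn u u' -> pi1 x < n by move=> /pi1_b; lia.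
pose h1 j := if j < N then j else j + d.
have h1_mono : strict_mono_below h1 n.
  by move=> j k jk _; rewrite /h1; case: (ltnP j N); case: (ltnP k N); lia.
have [|g1' g1'_inj g1'g1] := @insertion g1 h1 n _ h1_mono.
  by move=> j k _ _; apply: (can_inj g1K).
have [||g2 [pi2 [g2K pi2K g2g1' [red2 redA2]]]] := dense g1' (n + d) g1'_inj; first by lia.
  move=> j jn0; rewrite -g1g0 -?g1'g1 /h1; [|lia|lia].
  by rewrite ifT //; lia.
have g2g1 j : j < n -> g2 (h1 j) = g1 j.
  by move=> jn; rewrite g2g1' ?g1'g1 // /h1; case: (ltnP j N); lia.
set Y2 := join X _ in red2 redA2; set G2 := pullback_graph f pi2 in red2 redA2.
have Y12 w : w <= maxn u u' -> agree w Y1 Y2.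
  move=> wu; apply: agree_join; first exact: agree_refl.
  apply: (agree_pullback_lt pi1K g2K h1_mono g2g1) => x xw.
  by apply: pi1_n; lia.
have [z zu [nA1z [v A2z]]] : exists2 z, z < u & ~ domain e Y1 z /\ domain e Y2 z.
  apply: contrapT => same.
  have A12 : agree u (domain e Y1) (domain e Y2).
    move=> z zu; split=> [A1z|A2z].
      by have [/(_ A1z) H _] := u'_use z zu; apply/H/Y12; lia.
    by apply: contrapT => A1z; apply: same; exists z.
  have p1 : computes (join (domain e Y2) Y2) p m.*2 1.
    by apply/u_use/agree_join => //; apply: Y12; lia.
  suff nG2 : ~ join G2 Y2 m.*2 by have [_ /(_ nG2)/(computes_inj p1)] := red2 m.*2.
  rewrite join_even /G2 /pullback_graph /code_rel /= /m !npairE.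
  have i_n : i < n by lia.
  have fi_n : f i < n by rewrite -cut_n.
  case=> _ _; rewrite -(g2g1 i) // -(g2g1 (f i)) // !g2K /h1 ifF; last first.
    by have := cut_N i; lia.
  by rewrite ifF; [move=> E; apply: fd|lia].
have [u2 u2_use] := computes_use A2z.
have [b2 pi2_b] := image_bound pi2 u2.
have [h [h_id h_mono h_comm h_far]] := cut_embedding f_block cut_N isoN (N + d) cut_n ltac:(lia).
pose m2 := maxn b2 (n + d).
pose h2 j := if j < N + d then j else if j < n + d then h (j - d) else h n.-1 + (j - (n + d)).+1.
have h2_mono : strict_mono_below h2 m2.
  move=> j k jk _; rewrite /h2.
  have h_le a : a < n -> h a <= h n.-1.
    by move=> an; have [->|?] := eqVneq a n.-1; [|apply/ltnW/h_mono; lia].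
  case: (ltnP j (N + d)) => jN; case: (ltnP k (N + d)) => kN; try lia.
  - case: (ltnP k (n + d)) => kn.
      by have := h_far (k - d); lia.
    by have := h_far n.-1; lia.
  - case: (ltnP j (n + d)) => jn; case: (ltnP k (n + d)) => kn; try lia.
      by apply: h_mono; lia.
    by have := h_le (j - d); lia.
have [|g2' g2'_inj g2'g2] := @insertion g2 h2 m2 _ h2_mono.
  by move=> j k _ _; apply: (can_inj g2K).
have m2_gt : m2.-1 < m2 by lia.
have h2_lt j : j < m2 -> h2 j < (h2 m2.-1).+1.
  move=> jm; have [->|?] := eqVneq j m2.-1; first exact: ltnSn.
  by apply/ltnW/h2_mono; lia.
have h21 j : j < n -> h2 (h1 j) = h j.
  move=> jn; rewrite /h1; case: (ltnP j N) => jN; first by rewrite /h2 ifT ?h_id; lia.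
  by rewrite /h2 ifF ?ifT ?addnK //; lia.
have h1_m2 j : j < n -> h1 j < m2.
  by move=> jn; rewrite /h1; case: (ltnP j N); lia.
have [||g3 [pi3 [g3K pi3K g3g2' [red3 redA3]]]] := dense g2' (h2 m2.-1).+1 g2'_inj.
- by have := strict_mono_below_ge h2_mono m2_gt; lia.
- move=> j jn0; have jn : j < n by lia.
  have h1j : h1 j = j by rewrite /h1 ifT //; lia.
  rewrite -g1g0; last by lia.
  rewrite -g2g1 // -(g2'g2 _ (h1_m2 _ jn)) h21 // h_id //; lia.
have g3g2 j : j < m2 -> g3 (h2 j) = g2 j.
  by move=> jm; rewrite g3g2' ?g2'g2 //; apply: h2_lt.
have g3g1 j : j < n -> g3 (h j) = g1 j.
  by move=> jn; rewrite -h21 // g3g2 ?g2g1 //; apply: h1_m2.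
set Y3 := join X _ in red3 redA3; set G3 := pullback_graph f pi3 in red3 redA3.
have A3z : domain e Y3 z.
  exists v; apply/u2_use/agree_join; first exact: agree_refl.
  apply: (agree_pullback_lt pi2K g3K h2_mono g3g2) => x /pi2_b; rewrite /m2; lia.
have [q1 _] := redA3 z.*2; rewrite join_even in q1.
have [_ /(_ nA1z) q0] := u'_use z zu.
suff : 1 = 0 by [].
apply: (computes_inj (q1 A3z)); apply/q0/agree_join.
  apply: (agree_pullback_graph pi1K g3K h_mono h_comm cut_n g3g1) => x xu.
  by apply: pi1_n; lia.
apply: agree_join; first exact: agree_refl.
apply: (agree_pullback_lt pi1K g3K h_mono g3g1) => x xu.
by apply: pi1_n; lia.
Qed.

Lemma include_step (g0 : nat -> nat) n0 s : injective g0 -> exists g1 n1,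
  [/\ injective g1, n0 < n1, forall j, j < n0 -> g1 j = g0 j
    & exists2 j, j < n1 & g1 j = s].
Proof.
move=> g0_inj; have [[j jn gj]|none] := pselect (exists2 j, j < n0 & g0 j = s).
  by exists g0, n0.+1; split=> //; exists j => //; lia.
have [||g1 g1_inj g1E] := @insertion (fun j => if j < n0 then g0 j else s) id n0.+1.
- move=> i j; rewrite !ltnS => i_n j_n.
  case: (ltnP i n0) => i_n'; case: (ltnP j n0) => j_n'.
  + exact: g0_inj.
  + by move=> gi; case: none; exists i.
  + by move=> gj; case: none; exists j.
  + by lia.
- by [].
exists g1, n0.+1; split=> // [j jn|]; first by have := g1E j; rewrite ltnS (ltnW jn) jn; apply.
by exists n0 => //; have := g1E n0 (ltnSn n0); rewrite ltnn.
Qed.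

Lemma diagonal_copy f N0 X : block_function f ->
  (forall B, isolated_blocks f B -> forall x, B x -> x < N0) ->
  (forall N, exists2 i, N <= i & f i <> i) ->
  exists g pi, [/\ cancel g pi, cancel pi g
    & forall p q e, ~ ce_degree_via f X p q e pi].
Proof.
move=> f_block isoN0 moved; have [enum enumP] := prog_countable.
pose cond := ({g : nat -> nat | injective g} * nat)%type.
pose killed s (c : cond) := forall g pi, cancel g pi -> cancel pi g ->
  (forall j, j < c.2 -> g j = sval c.1 j) ->
  ~ ce_degree_via f X (enum (nfst s)) (enum (nfst (nsnd s))) (enum (nsnd (nsnd s))) pi.
have step (sc : nat * cond) : exists c' : cond, [/\ sc.2.2 < c'.2,
    forall j, j < sc.2.2 -> sval c'.1 j = sval sc.2.1 j,
    exists2 j, j < c'.2 & sval c'.1 j = sc.1 & killed sc.1 c'].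
  case: sc => s [[g0 g0_inj] n0] /=.
  have [g1 [n1 [g1_inj n01 g10 [j jn1 g1j]]]] := include_step n0 s g0_inj.
  have [g2 [n2 [g2_inj n12 g21 kill]]] := diagonal_step X (enum (nfst s))
    (enum (nfst (nsnd s))) (enum (nsnd (nsnd s))) f_block isoN0 moved n1 g1_inj.
  exists (exist _ g2 g2_inj, n2); split=> //=; first by lia.
    by move=> k kn; rewrite g21 ?g10 //; lia.
  by exists j; [lia|rewrite g21].
have [next nextP] := choice step.
pose c := nat_rect (fun=> cond) (exist _ id (@inj_id nat), 0) (fun s c => next (s, c)).
have c_size s : s <= (c s).2.
  by elim: s => // s IHs /=; have [/=] := nextP (s, c s); lia.
have c_ext s t j : s <= t -> j < (c s).2 -> j < (c t).2 /\ sval (c t).1 j = sval (c s).1 j.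
  move=> /subnK <-; elim: (t - s) => [//|k IHk] jn /=.
  have [jk <-] := IHk jn; have [/= lt ext _ _] := nextP (k + s, c (k + s)).
  by split; [lia|apply: ext].
pose g j := sval (c j.+1).1 j.
have gE s j : j < (c s).2 -> g j = sval (c s).1 j.
  move=> jn; rewrite /g; have [sj|js] := leqP s j.+1.
    by have [] := c_ext s j.+1 j sj jn.
  by have [_ ->] := c_ext j.+1 s j (ltnW js) (c_size j.+1).
have g_inj : injective g.
  move=> i j; pose s := (maxn i j).+1.
  have s_size := c_size s; rewrite (gE s i) ?(gE s j) ?(leq_trans _ s_size) ?ltnS
    ?leq_maxl ?leq_maxr //.
  exact: (svalP (c s).1).
have g_surj x : exists j, g j = x.
  have [_ _ [k kn gk] _] := nextP (x, c x).
  by exists k; rewrite (gE x.+1).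
have [pi piK] := choice g_surj.
have gK : cancel g pi by move=> k; apply/g_inj/piK.
exists g, pi; split=> // p q e.
have [a ap] := enumP p; have [b bq] := enumP q; have [k ke] := enumP e.
pose s := npair a (npair b k).
have [_ _ _ /(_ g pi gK piK)] := nextP (s, c s).
by rewrite /s /= !npairE ap bq ke; apply => j; apply: (gE s.+1).
Qed.

Lemma pullback_lt_copy g pi : cancel g pi -> cancel pi g ->
  copy_of_omega setT (fun x y => pi x < pi y) pi.
Proof.
move=> gK piK; split=> //; split=> // [x y _ _|x _]; first exact: (can_inj piK).
by exists (g x).
Qed.

Lemma not_ce_degree_on_cone f : block_function f ->
  finite_set (isolated_blocks f) -> (forall N, exists2 i, N <= i & f i <> i) ->
  ~ intrinsically_ce_degree_on_cone f.
Proof.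
move=> f_block /finite_blocks_bounded[N0 isoN0] moved [X ce_X].
have [g [pi [gK piK not_via]]] := diagonal_copy X f_block isoN0 moved.
pose Y := join X (pullback_lt pi).
have [|A [e eA] degA] := ce_X Y (join_l _ _)
    (degree (join (pullback_graph f pi) Y)).
  exists setT, (fun x y => pi x < pi y), pi; split=> //.
    exact: pullback_lt_copy gK piK.
  split; last exact: join_r.
  by apply/turing_leP; exists (fun=> 1) => //; apply: computable_const.
have AE : A = domain e Y.
  by apply/funext => n; apply/propext; have [? ?] := eA n; split.
have [[p pP] [q qP]] : turing_equiv (join (pullback_graph f pi) Y) (join A Y).
  have : degree (join A Y) (join A Y) by apply: turing_equiv_refl.
  by rewrite -degA.
by apply: (not_via p q e); split; rewrite -/Y -AE.
Qed.

(** * Copies of c.e. degree *)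

Lemma turing_le_graph_computable f X :
  turing_le (fun m => nsnd m = f (nfst m)) X -> computable X f.
Proof.
move=> /sigma1_search[p pP]; exists p => n; apply/pP.
by rewrite !npairE; split=> // m; rewrite !npairE; lia.
Qed.

Lemma copy_enum L prec pi : copy_of_omega L prec pi ->
  exists2 r, forall k, L (r k) & (forall k, pi (r k) = k) /\
    forall x, L x -> r (pi x) = x.
Proof.
move=> [_ [_ pi_inj pi_surj] _].
have [k|r rP] := @choice _ _ (fun k x => L x /\ pi x = k).
  by have [x Lx <-] := pi_surj k I; exists x.
exists r => [k|]; first by have [] := rP k.
split=> [k|x Lx]; first by have [] := rP k.
by have [Lr pir] := rP (pi x); apply: pi_inj => //; apply/mem_set.
Qed.

Definition rank_set (L : set nat) (pi : nat -> nat) : set nat :=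
  [set m | L (nfst m) /\ nsnd m <= pi (nfst m)].

Definition position (L : set nat) (pi : nat -> nat) : set nat :=
  [set m | L (nfst m) /\ pi (nfst m) = nsnd m].

Lemma rank_set_sigma1 L prec pi X : copy_of_omega L prec pi ->
  computable_order X L prec -> sigma1 (rank_set L pi) X.
Proof.
move=> copyL [LX precX]; have [prec_L _ prec_lt] := copyL.
have [r Lr [pi_r _]] := copy_enum copyL.
exists (fun v => L (nfst (nfst v)) /\
  (sget (nsnd v) (nsnd (nfst v)) = nfst (nfst v) /\
   forall j, j < nsnd (nfst v) ->
     code_rel prec (npair (sget (nsnd (nfst (npair v j))) (nsnd (npair v j)))
                          (sget (nsnd (nfst (npair v j))) (nsnd (npair v j)).+1)))).
  apply: turing_le_and; first by apply: turing_le_preimage; auto with comp.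
  apply: turing_le_and; first by apply: turing_le_eq; [apply: computable_sget|]; auto with comp.
  apply: (@turing_le_ball (fun w => code_rel prec
     (npair (sget (nsnd (nfst w)) (nsnd w)) (sget (nsnd (nfst w)) (nsnd w).+1)))).
    by apply: turing_le_preimage => //; apply: computable_pair;
      apply: computable_sget; auto with comp.
  by auto with comp.
move=> m; rewrite /rank_set /=; split=> [[Lx kx]|[s]].
  have [s sE] := sget_surj (nsnd m).+1 (fun j => if j < nsnd m then r j else nfst m).
  exists s; rewrite !npairE; split=> //; split=> [|j jm]; first by rewrite sE ?ltnn.
  rewrite !npairE /code_rel /= !npairE !sE ?jm; try lia.
  apply/prec_lt => //; first by case: ifP.
  by case: ifP => // _; rewrite !pi_r; lia.
rewrite !npairE => -[Lx [sm chain]]; split=> //.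
suff : forall k, k < (nsnd m).+1 -> k <= pi (sget s k).
  by rewrite -sm; apply.
elim=> // k IHk km; have := chain k km; rewrite !npairE /code_rel /= !npairE.
move=> /[dup] /prec_L[L1 L2] /(prec_lt _ _ L1 L2).
by have := IHk (ltnW km); lia.
Qed.

Lemma position_sigma1 f L prec pi X : copy_of_omega L prec pi ->
  computable_order X L prec -> computable X f ->
  turing_le (code_rel (transport_graph f L pi)) X ->
  turing_le (fun n => cut f n /\ rigid f n) X ->
  (forall M, exists n, [/\ M < n, cut f n & rigid f n]) ->
  sigma1 (position L pi) X.
Proof.
move=> copyL [LX precX] f_comp graphX rigidX many.
have [prec_L _ prec_lt] := copyL.
have [r Lr [pi_r rpi]] := copy_enum copyL.
pose seq_lt w := code_rel prec
  (npair (sget (nsnd (nsnd (nfst w))) (nsnd w)) (sget (nsnd (nsnd (nfst w))) (nsnd w).+1)).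
pose seq_graph w := code_rel (transport_graph f L pi)
  (npair (sget (nsnd (nsnd (nfst w))) (nsnd w)) (sget (nsnd (nsnd (nfst w))) (f (nsnd w)))).
exists (fun v => (cut f (nfst (nsnd v)) /\ rigid f (nfst (nsnd v))) /\
  ((nsnd (nfst v)).+1 <= nfst (nsnd v) /\
  (sget (nsnd (nsnd v)) (nsnd (nfst v)) = nfst (nfst v) /\
  ((forall j, j < (nfst (nsnd v)).-1 -> seq_lt (npair v j)) /\
   (forall j, j < nfst (nsnd v) -> seq_graph (npair v j)))))).
  apply: turing_le_and.
    by apply: (turing_le_preimage rigidX); auto with comp.
  apply: turing_le_and; first by apply: turing_le_leq; auto with comp.
  apply: turing_le_and.
    by apply: turing_le_eq; [apply: computable_sget|]; auto with comp.
  apply: turing_le_and; apply: turing_le_ball.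
  - apply: (turing_le_preimage precX).
    by apply: computable_pair; apply: computable_sget; auto with comp.
  - by apply: computable_pred; auto with comp.
  - apply: (turing_le_preimage graphX).
    apply: computable_pair; apply: computable_sget; auto with comp.
    by apply: (computable_comp f_comp); auto with comp.
  - by auto with comp.
move=> m; rewrite /position /=; split=> [[Lx xm]|[v]].
  have [n [mn cut_n rigid_n]] := many (nsnd m).
  have [s sE] := sget_surj n r.
  exists (npair n s); rewrite !npairE; split=> //; split=> //.
  split; first by rewrite sE // -xm rpi.
  rewrite /seq_lt /seq_graph /code_rel; split=> j jn /=; rewrite !npairE.
    by rewrite !sE; [apply/prec_lt; rewrite // !pi_r| |]; lia.
  by rewrite !sE -?cut_n //; split; rewrite ?pi_r.
rewrite -(npairK v); move: (nfst v) (nsnd v) => n s; rewrite !npairE.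
move=> [[_ rigid_n] [mn [sm [chain graph]]]].
have Ls j : j < n -> L (sget s j).
  by move=> /graph; rewrite /seq_graph /code_rel /= !npairE => -[].
suff pis j : j < n -> pi (sget s j) = j by rewrite -sm pis //; split=> //; apply: Ls.
apply: (rigid_n (fun j => pi (sget s j))) => [i k|k kn].
  elim: k => // k IHk; rewrite ltnS leq_eqVlt => ik kn.
  have lt_k : pi (sget s k) < pi (sget s k.+1).
    apply/prec_lt; [apply: Ls; lia|exact: Ls|].
    by have := chain k; rewrite /seq_lt /code_rel /= !npairE; apply; lia.
  by case/predU1P: ik => [->//|/IHk]; lia.
by have := graph k kn; rewrite /seq_graph /code_rel /= !npairE => -[].
Qed.

Lemma rank_set_position L pi X : turing_le L X -> sigma1 (position L pi) X ->
  turing_le (rank_set L pi) X.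
Proof.
move=> LX posX; have posX' : sigma1 (fun v => position L pi (npair (nfst (nfst v)) (nsnd v))) X.
  by apply: sigma1_preimage => //; auto with comp.
apply: delta1_turing_le.
  apply: (sigma1_ext _ (sigma1_ex (sigma1_and posX'
    (turing_le_sigma1 (turing_le_leq (F := fun v => nsnd (nfst v)) (G := nsnd) _ _))))).
  - move=> m; rewrite /rank_set /position /=; split=> [[Lx mx]|[k]].
      by exists (pi (nfst m)); rewrite !npairE.
    by rewrite !npairE => -[[Lx ->]].
  - by auto with comp.
  - by exists PSnd.
apply: (sigma1_ext _ (sigma1_or (turing_le_sigma1 (turing_le_not
  (turing_le_preimage LX (F := nfst) _))) (sigma1_ex (sigma1_and posX'
    (turing_le_sigma1 (turing_le_leq (F := fun v => (nsnd v).+1) (G := fun v => nsnd (nfst v)) _ _)))))).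
- move=> m; rewrite /rank_set /position /=; split=> [nA|[nL []|[k] + []]] //.
    have [Lx|nLx] := pselect (L (nfst m)); [right|by left].
    exists (pi (nfst m)); rewrite !npairE; split=> //.
    by rewrite ltnNge; apply/negP => mx; apply: nA.
  by rewrite !npairE => -[[Lx ->]]; lia.
- by exists PFst.
- by auto with comp.
- by auto with comp.
Qed.

Lemma graph_rank_set f L pi X : set_bij L setT pi -> turing_le L X -> computable X f ->
  turing_le (rank_set L pi) X -> turing_le (code_rel (transport_graph f L pi)) X.
Proof.
move=> [_ pi_inj _] LX f_comp rankX.
have posX : turing_le (position L pi) X.
  apply: (turing_le_ext _ (turing_le_and rankX (turing_le_not
    (turing_le_preimage rankX (F := fun m => npair (nfst m) (nsnd m).+1) _)))).
    move=> m; rewrite /position /rank_set /= !npairE.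
    split=> [[Lx <-]|[[Lx mx] nx]]; first by split=> // -[_]; rewrite ltnn.
    by split=> //; apply/eqP; rewrite eqn_leq mx andbT leqNgt; apply/negP => ?; apply: nx.
  by auto with comp.
pose pos_fst v := position L pi (npair (nfst (nfst v)) (nsnd v)).
pose pos_snd v := position L pi (npair (nsnd (nfst v)) (f (nsnd v))).
have fstX : turing_le pos_fst X by apply: turing_le_preimage; auto with comp.
have sndX : turing_le pos_snd X.
  apply: turing_le_preimage => //; apply: computable_pair; first by auto with comp.
  by apply: computable_comp => //; exists PSnd.
apply: delta1_turing_le.
  apply: (sigma1_ext _ (sigma1_ex (turing_le_sigma1 (turing_le_and fstX sndX)))) => m.
  rewrite /code_rel /transport_graph /pos_fst /pos_snd /position /=.
  split=> [[Lx Ly yx]|[k]]; first by exists (pi (nfst m)); rewrite !npairE.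
  by rewrite !npairE => -[[Lx <-] [Ly ->]].
apply: (sigma1_ext _ (sigma1_or (turing_le_sigma1 (turing_le_not
  (turing_le_preimage LX (F := nfst) _)))
  (sigma1_ex (turing_le_sigma1 (turing_le_and fstX (turing_le_not sndX)))))).
- move=> m; rewrite /code_rel /transport_graph /pos_fst /pos_snd /position /=.
  split=> [nG|[nL []|[k] + []]] //.
    have [Lx|nLx] := pselect (L (nfst m)); [right|by left].
    by exists (pi (nfst m)); rewrite !npairE; split=> // -[Ly yx]; apply: nG.
  by rewrite !npairE => -[[_ <-] nY] _ Ly yx; apply: nY.
- by exists PFst.
Qed.

Lemma ce_degree_on_cone f :
  (forall M, exists n, [/\ M < n, cut f n & rigid f n]) ->
  intrinsically_ce_degree_on_cone f.
Proof.
move=> many.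
exists (join (fun m => nsnd m = f (nfst m)) (fun n => cut f n /\ rigid f n)).
move=> Y XY _ [L [prec [pi [copyL compL ->]]]].
have f_comp Z : turing_le Y Z -> computable Z f.
  move=> YZ; apply: turing_le_graph_computable.
  exact: turing_le_trans (join_l _ _) (turing_le_trans XY YZ).
have [LY precY] := compL; have [_ bij_pi _] := copyL.
exists (rank_set L pi); first by apply/sigma1_ce/(rank_set_sigma1 copyL).
apply: degree_eq; split; apply: join_lub; try exact: join_r.
  apply: (graph_rank_set bij_pi) (join_l _ _); last by apply/f_comp/join_r.
  exact: turing_le_trans LY (join_r _ _).
apply: rank_set_position; first exact: turing_le_trans LY (join_r _ _).
apply: (position_sigma1 copyL _ _ (join_l _ _) _ many).
- by split; [apply: turing_le_trans LY _|apply: turing_le_trans precY _]; apply: join_r.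
- exact/f_comp/join_r.
- exact: turing_le_trans (join_r _ _) (turing_le_trans XY (join_r _ _)).
Qed.

Lemma eventually_id_computable f N : (forall i, N <= i -> f i = i) ->
  intrinsically_computable_on_cone f.
Proof.
move=> f_id; exists set0 => Y _.
have degE L prec pi : copy_of_omega L prec pi -> turing_le L Y ->
    degree (join (code_rel (transport_graph f L pi)) Y) = degree Y.
  move=> copyL LY; have [r Lr [pi_r rpi]] := copy_enum copyL.
  apply: degree_eq; split; last exact: join_r.
  apply: join_lub; last exact: turing_le_refl.
  have [b1 Hb1] := image_bound (fun k => npair (r k) (r k)) N.
  have [b2 Hb2] := image_bound (fun k => npair (r k) (r (f k))) N.
  apply: (@turing_le_finite_variant (fun m => L (nfst m) /\ nfst m = nsnd m) _ _
    (maxn b1 b2)); last first.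
    apply: turing_le_and; last by apply: turing_le_eq; [exists PFst|exists PSnd].
    by apply: turing_le_preimage => //; exists PFst.
  move=> m mb; rewrite /code_rel /transport_graph /=.
  have [Nm|mN] := leqP N (pi (nfst m)).
    rewrite f_id //; split=> [[Lx <-]//|[Lx Ly yx]]; split=> //.
    by rewrite -(rpi _ Lx) -(rpi _ Ly) yx.
  split=> [[Lx xy]|[Lx Ly yx]].
    by have := Hb1 _ mN; rewrite rpi // {2}xy npairK; lia.
  by have := Hb2 _ mN; rewrite -yx !rpi // npairK; lia.
apply/seteqP; split=> [_ [L [prec [pi [copyL [LY _] ->]]]]|_ ->].
  exact: degE copyL LY.
have allY : turing_le setT Y.
  by apply/turing_leP; exists (fun=> 1) => //; apply: computable_const.
exists setT, (fun x y => x < y), id.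
have copyT : copy_of_omega setT (fun x y => x < y) id by apply: (@pullback_lt_copy id id).
split=> //; last by rewrite (degE _ _ _ copyT).
split=> //; rewrite /code_rel.
by apply: (@turing_le_leq Y (fun m => (nfst m).+1) nsnd); [auto with comp|exists PSnd].
Qed.

Theorem theorem3p3 (f : nat -> nat)
    (f_block : block_function f)
    (f_not_computable : ~ intrinsically_computable_on_cone f) :
  intrinsically_ce_degree_on_cone f <->
  infinite_set [set B | block f B /\
                        ~ exists C, [/\ block f C, later B C & embeds f B C]].
Proof.
split=> [f_ce fin|inf]; last exact/ce_degree_on_cone/rigid_unbounded.
apply: (not_ce_degree_on_cone f_block fin) f_ce => N.
apply: contrapT => none; apply: f_not_computable.
apply: (@eventually_id_computable f N) => i Ni.
by apply: contrapT => fi; apply: none; exists i.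
Qed.
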